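(* Let $K$ be a compact metric space, $\Phi=\{\varphi_1,\dots,\varphi_n\}$ a system of linearly independent real-valued functions in $C(K)$, $\mathcal{P}$ the space of polynomials by the system $\Phi$, and $f\in C(K)$. A polynomial $p\in\mathcal{P}$ is a polynomial of best approximation for $f$ (that is, $\|p-f\|\le\|q-f\|$ for all $q\in\mathcal{P}$) if and only if $p$ has a generalized alternance.
   Context: $C(K)$ is the space of continuous real functions on $K$ with the uniform norm $\|g\|=\max_{t\in K}|g(t)|$. A polynomial by the system $\Phi$ is a linear combination $p=\sum_{k=1}^n p^k\varphi_k$ with $p^k\in\mathbb{R}$; $\mathcal{P}$ is the linear space of all of them. The moment vector of $t\in K$ is $\boldsymbol{u}(t)=(\varphi_1(t),\dots,\varphi_n(t))^T\in\mathbb{R}^n$. Generalized alternance: given $f$, a polynomial $p\in\mathcal{P}$ has a generalized alternance $\{\tau_1,\dots,\tau_m\}$, where $\tau_i\in K$ and $1\le m\le n+1$, if there are signs $\sigma_1,\dots,\sigma_m\in\{-1,1\}$ such that (1) $p(\tau_i)-f(\tau_i)=\sigma_i\|p-f\|$ for all $i=1,\dots,m$; and (2) the convex hull of the vectors $\{\sigma_i\boldsymbol{u}(\tau_i)\}_{i=1}^m$ in $\mathbb{R}^n$ contains the origin. The points are given as an indexed list; they are not required to be distinct. *)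

(* Defs.v *)
From HB Require Import structures.
From mathcomp Require Import all_boot all_order all_algebra.
From mathcomp Require Import all_classical all_reals all_analysis.

Set Implicit Arguments.
Unset Strict Implicit.
Unset Printing Implicit Defensive.

Import Order.TTheory GRing.Theory Num.Theory.
Import numFieldNormedType.Exports.

Local Open Scope classical_set_scope.
Local Open Scope ring_scope.

(* On a nonempty compact space this supremum is a maximum when [g] is
   continuous, see [unorm_max] below. *)
Definition unorm (R : realType) (K : Type) (g : K -> R) : R :=
  sup (range (fun t => `|g t|)).

Lemma unorm_max (R : realType) (K : metricType R) (g : K -> R) :
  compact [set: K] -> [set: K] !=set0 -> continuous g ->
  exists t, unorm g = `|g t| /\ forall s, `|g s| <= unorm g.
Proof.
move=> cK K0 cg.
have cng : {within [set: K], continuous (fun t => `|g t|)}.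
  by apply: continuous_subspaceT => t; apply: cvg_norm; exact: cg.
have [t _ ht] := compact_EVT_max K0 cK cng.
have ubt s : `|g s| <= `|g t| by apply: ht; rewrite inE.
have {ht}E : unorm g = `|g t|.
  apply/eqP; rewrite eq_le; apply/andP; split.
    by apply: ge_sup; [exists `|g t|, t | move=> _ [s _ <-]; exact: ubt].
  apply: ub_le_sup; last by exists t.
  by exists `|g t| => _ [s _ <-]; exact: ubt.
by exists t; split=> // s; rewrite E.
Qed.

Definition polynomials (R : realType) (K : Type) (n : nat)
    (phi : 'I_n -> K -> R) : set (K -> R) :=
  [set \sum_(k < n) c k *: phi k | c in [set: 'I_n -> R]].

Definition linearly_independent (R : realType) (K : Type) (n : nat)
    (phi : 'I_n -> K -> R) : Prop :=
  forall c : 'I_n -> R, \sum_(k < n) c k *: phi k = 0 -> forall k, c k = 0.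

Definition moment (R : realType) (K : Type) (n : nat)
    (phi : 'I_n -> K -> R) (t : K) : 'cV[R]_n :=
  \col_(k < n) phi k t.

Definition convex_hull (R : realType) (V : lmodType R) (A : set V) : set V :=
  smallest (@convex_set R V) A.

Definition best_approximation (R : realType) (K : Type) (n : nat)
    (phi : 'I_n -> K -> R) (f p : K -> R) : Prop :=
  forall q, polynomials phi q -> unorm (p - f) <= unorm (q - f).

Definition generalized_alternance (R : realType) (K : Type) (n : nat)
    (phi : 'I_n -> K -> R) (f p : K -> R) (m : nat) (tau : 'I_m -> K) : Prop :=
  exists sigma : 'I_m -> R,
    [/\ forall i, sigma i = -1 \/ sigma i = 1,
        forall i, p (tau i) - f (tau i) = sigma i * unorm (p - f) &
        convex_hull (range (fun i => sigma i *: moment phi (tau i))) 0].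

Definition has_generalized_alternance (R : realType) (K : Type) (n : nat)
    (phi : 'I_n -> K -> R) (f p : K -> R) : Prop :=
  exists (m : nat) (tau : 'I_m -> K),
    (1 <= m <= n.+1)%N /\ generalized_alternance phi f p tau.

(* Main.v *)
Require Import Defs.
From mathcomp Require Import all_boot all_order all_algebra.
From mathcomp Require Import all_classical all_reals all_analysis.
From mathcomp Require Import ring lra.

Set Implicit Arguments.
Unset Strict Implicit.
Unset Printing Implicit Defensive.

Import numFieldNormedType.Exports.
Import Order.TTheory GRing.Theory Num.Theory.
Local Open Scope classical_set_scope.
Local Open Scope ring_scope.

(** Write N for the norm of the error e = p - f, and call a pair (t, s) with
    s = 1 or s = -1 extremal when e t = s * N.

    Alternance implies optimality.  If some q in the span had a smaller error,
    then s * (q - p) t < 0 at every extremal pair.  The coefficients of q - p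
    define a linear form that is negative on every signed moment vector
    s *: u(t) of the alternance; an open half-space is convex, so the form is
    negative on the whole hull and the hull misses the origin
    ([alternance_best_approximation]).

    Optimality implies alternance.  The extremal pairs form a compact set on
    which the signed moment vector is continuous.  A compact form of Gordan's
    theorem of the alternative ([compact_gordan]) leaves two cases.  Either 0 is
    a convex combination of n + 1 signed moment vectors, which is an alternance
    of n + 1 points (with repetitions or null weights when fewer suffice); or
    some d in the span satisfies s * d t > 0 at all extremal pairs.
    In the second case d has the sign of e wherever |e| is maximal, so a small
    multiple of d subtracted from p lowers the error everywhere
    ([uniform_decrease]), and p is not optimal.

    Gordan's alternative is proved by taking a point x of least Euclidean norm
    among the convex combinations of n + 1 vectors.  That set is the
    continuous image of a compact space, so x exists.  Moving x towards any
    vector of the family gives a convex combination of n + 2 vectors, which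
    Caratheodory's theorem rewrites with n + 1; hence its norm is
    at least that of x, and if x is not 0 the form (x | _) is positive on the
    family.  The number n + 1 of points thus comes from Caratheodory. *)

(** * Convex combinations and Caratheodory's theorem *)

(** Any d + 1 vectors of a d-dimensional space satisfy a nontrivial linear
    relation, which may be taken to have a positive coefficient.  Subtracting
    the largest multiple of it that keeps the weights nonnegative cancels one
    weight and leaves the sum unchanged. *)
Lemma conic_caratheodory (F : realFieldType) (d : nat)
    (w : 'I_d.+1 -> 'rV[F]_d) (a : 'I_d.+1 -> F) :
  (forall i, 0 <= a i) ->
  exists b : 'I_d.+1 -> F, [/\ forall i, 0 <= b i, exists j, b j = 0 &
    \sum_i b i *: w i = \sum_i a i *: w i].
Proof.
move=> a0.
pose A : 'M[F]_(d.+1, d) := \matrix_i w i.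
have kerA : kermx A != 0.
  rewrite -mxrank_eq0 mxrank_ker -lt0n subn_gt0 ltnS.
  exact: rank_leq_col.
have [mu [i0 mui0] muw] : exists2 mu : 'I_d.+1 -> F,
    exists i, 0 < mu i & \sum_i mu i *: w i = 0.
  have /rowV0Pn[r rA r0] := kerA.
  have rw : \sum_i r 0 i *: w i = 0.
    apply: eq_trans (sub_kermxP rA); rewrite mulmx_sum_row.
    by apply: eq_bigr => i _; rewrite rowK.
  have /rV0Pn[i ri] := r0.
  have [ri0|] := ltP 0 (r 0 i); first by exists (r 0) => //; exists i.
  rewrite le_eqVlt (negbTE ri) /= => ri0.
  exists (fun i => - r 0 i); first by exists i; rewrite oppr_gt0.
  under eq_bigr do rewrite scaleNr.
  by rewrite sumrN rw oppr0.
(* The index with the least ratio is the first whose weight vanishes. *)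
have [j muj jmin] := arg_minP (P := fun i => 0 < mu i) (fun i => a i / mu i) mui0.
pose s := a j / mu j.
have s0 : 0 <= s by rewrite divr_ge0 // ltW.
exists (fun i => a i - s * mu i); split.
- move=> i; rewrite subr_ge0; have [mi|mi] := ltP 0 (mu i).
    by rewrite -ler_pdivlMr //; exact: jmin.
  by rewrite (le_trans _ (a0 i)) // mulr_ge0_le0.
- by exists j; rewrite /s divfK ?subrr // gt_eqF.
- under eq_bigr do rewrite scalerBl -scalerA.
  by rewrite sumrB -scaler_sumr muw scaler0 subr0.
Qed.

(** Putting a coordinate 1 in front of each vector makes conic combinations
    keep track of the total weight, so the conic statement in dimension n + 1
    becomes the convex one in dimension n. *)
Lemma caratheodory_step (F : realFieldType) (n : nat)
    (x : 'I_n.+2 -> 'cV[F]_n) (a : 'I_n.+2 -> F) :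
  (forall i, 0 <= a i) -> \sum_i a i = 1 ->
  exists (j : 'I_n.+2) (b : 'I_n.+1 -> F), [/\ forall i, 0 <= b i,
    \sum_i b i = 1 & \sum_i b i *: x (lift j i) = \sum_i a i *: x i].
Proof.
move=> a0 a1.
pose w i : 'rV[F]_n.+1 :=
  \row_k if unlift ord0 k is Some k' then x i k' 0 else 1.
have [b [b0 [j bj] bw]] := conic_caratheodory w a0.
exists j, (fun i => b (lift j i)); split=> [i||]; first exact: b0.
- have := congr1 (fun M : 'rV_n.+1 => M 0 ord0) bw.
  rewrite !summxE; under eq_bigr do rewrite !mxE unlift_none mulr1.
  under [RHS]eq_bigr do rewrite !mxE unlift_none mulr1.
  by rewrite a1 (bigD1_ord j) //= bj add0r.
- apply/matrixP => k z; rewrite {z}ord1.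
  have := congr1 (fun M : 'rV_n.+1 => M 0 (lift ord0 k)) bw.
  rewrite !summxE; under eq_bigr do rewrite !mxE liftK.
  under [RHS]eq_bigr do rewrite !mxE liftK.
  rewrite (bigD1_ord j) //= bj mul0r add0r => E.
  under eq_bigr do rewrite mxE.
  by under [RHS]eq_bigr do rewrite mxE.
Qed.

Lemma convex_set_sum (R : realFieldType) (V : lmodType R) (A : set V) (m : nat)
    (x : 'I_m -> V) (a : 'I_m -> R) :
  convex_set (A : set (convex_lmodType V)) -> (forall i, A (x i)) ->
  (forall i, 0 <= a i) -> \sum_i a i = 1 -> A (\sum_i a i *: x i).
Proof.
move=> cA; elim: m x a => [|m IH] x a Ax a0.
  by rewrite big_ord0 => /eqP; rewrite eq_sym oner_eq0.
rewrite !big_ord_recl => a1.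
set r := \sum_(i < m) a (lift ord0 i) in a1.
have r0 : 0 <= r by apply: sumr_ge0 => i _; exact: a0.
have [rz|rn0] := eqVneq r 0.
  have az i : a (lift ord0 i) = 0.
    have /psumr_eq0P : forall i : 'I_m, true -> 0 <= a (lift ord0 i) by [].
    by move=> /(_ rz i); exact.
  rewrite big1 => [|i _]; last by rewrite az scale0r.
  by move: a1; rewrite rz !addr0 => ->; rewrite scale1r.
have Ay : A (\sum_(i < m) (a (lift ord0 i) / r) *: x (lift ord0 i)).
  apply: IH => [i|i|]; [exact: Ax|by rewrite divr_ge0|].
  by rewrite -mulr_suml divff.
(* Binary convexity joins the first point to the normalised sum of the rest. *)
have a01 : a ord0 <= 1 by rewrite -a1 lerDl.
have := cA _ _ (Itv01 (a0 ord0) a01) (mem_set (Ax ord0)) (mem_set Ay).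
rewrite inE /conv/=; congr A; congr (_ + _).
have -> : unstable.onem (a ord0) = r.
  by rewrite /unstable.onem -a1 addrAC subrr add0r.
rewrite scaler_sumr; apply: eq_bigr => i _.
by rewrite scalerA mulrCA divff ?mulr1.
Qed.

(** * Continuity of the auxiliary maps *)

Lemma pointwise_sum_continuous (R : realType) (T : topologicalType) (m : nat)
    (g : 'I_m -> T -> R) :
  (forall i, continuous (g i)) -> continuous (fun t => \sum_i g i t).
Proof.
by move=> cg; apply: (@continuous_big R 'I_m +%R 0 xpredT (@add_continuous R)).
Qed.

Lemma fst_continuous (T U : topologicalType) : continuous (@fst T U).
Proof. by move=> [a b]; exact: cvg_fst. Qed.

Lemma snd_continuous (T U : topologicalType) : continuous (@snd T U).
Proof. by move=> [a b]; exact: cvg_snd. Qed.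

Lemma comp_continuous (T U V : topologicalType) (f : T -> U) (g : U -> V) :
  continuous f -> continuous g -> continuous (fun t => g (f t)).
Proof. by move=> cf cg t; exact: continuous_comp (cf t) (cg (f t)). Qed.

Lemma pointwise_mul_continuous (R : realType) (T : topologicalType)
    (f g : T -> R) :
  continuous f -> continuous g -> continuous (fun t => f t * g t).
Proof. by move=> cf cg t; apply: cvgM; [exact: cf|exact: cg]. Qed.

(** * Lowering the uniform norm *)

(** Pointwise, N^2 - (e - eps * d)^2 = al + 2 * eps * be - eps^2 * d^2 with
    al = N^2 - e^2 and be = e * d.  Since al >= 0 and be > 0 where al = 0, the
    continuous function max(al, be) has a positive minimum D on K: where
    be >= D the linear term in eps wins, and where al >= D the constant term
    wins, both for one eps small enough. *)
Lemma uniform_decrease (R : realType) (K : topologicalType) (e d : K -> R)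
    (N : R) :
  [set: K] !=set0 -> compact [set: K] -> continuous e -> continuous d ->
  (forall t, `|e t| <= N) -> (forall t, `|e t| = N -> 0 < e t * d t) ->
  exists eps, forall t, `|e t - eps * d t| < N.
Proof.
move=> K0 cK ce cd eN ed.
have N0 : 0 <= N by case: K0 => t _; exact: le_trans (eN t).
pose al t := N ^+ 2 - e t ^+ 2.
pose be t := e t * d t.
pose h t : R^o := Num.max (al t) (be t).
have cal : continuous al.
  by move=> t; apply: cvgB; [exact: cvg_cst | apply: cvgM; exact: ce].
have cbe : continuous be by move=> t; apply: cvgM; [exact: ce|exact: cd].
have ch : {within [set: K], continuous h}.
  by apply: continuous_subspaceT => t; apply: continuous_max; [exact: cal|exact: cbe].
have cQ : {within [set: K], continuous (fun t => 2 * `|be t| + d t ^+ 2)}.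
  apply: continuous_subspaceT => t; apply: cvgD.
    by apply: cvgM; [exact: cvg_cst|apply: cvg_norm; exact: cbe].
  by apply: cvgM; exact: cd.
have al0 t : 0 <= al t.
  by rewrite subr_ge0 -real_normK ?num_real // ler_pXn2r ?nnegrE.
have h0 t : 0 < h t.
  rewrite /h lt_max; have [et|et] := eqVneq `|e t| N.
    by rewrite [X in _ || X]ed ?orbT.
  rewrite subr_gt0 -real_normK ?num_real // ltr_pXn2r ?nnegrE //.
  by rewrite lt_neqAle et eN.
have [t0 _ hmin] := compact_EVT_min K0 cK ch.
have [t1 _ Qmax] := compact_EVT_max K0 cK cQ.
pose D := h t0; pose Q := 2 * `|be t1| + d t1 ^+ 2.
have D0 : 0 < D := h0 t0.
have Q0 : 0 <= Q by apply: addr_ge0; [exact: mulr_ge0|exact: sqr_ge0].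
(* Q bounds 2 * |be| + d^2, and this eps satisfies eps <= 1 and eps * Q < D. *)
pose eps := D / (D + Q).
have DQ : 0 < D + Q by rewrite ltr_wpDr.
have eps0 : 0 < eps by rewrite divr_gt0.
have eps1 : eps <= 1 by rewrite ler_pdivrMr // mul1r lerDl.
have epsQ : eps * Q < D.
  by rewrite mulrAC ltr_pdivrMr // ltr_pM2l // ltrDr.
exists eps => t.
rewrite -(ltr_pXn2r (n := 2)) ?nnegrE // real_normK ?num_real //.
rewrite -subr_gt0.
have -> : N ^+ 2 - (e t - eps * d t) ^+ 2
   = al t + eps * (2 * be t - eps * d t ^+ 2) by rewrite /al /be; ring.
have Qt : 2 * `|be t| + d t ^+ 2 <= Q by apply: Qmax; rewrite inE.
have d2 : eps * d t ^+ 2 <= d t ^+ 2 by rewrite ler_piMl ?sqr_ge0.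
have d2Q : eps * d t ^+ 2 <= eps * Q.
  by rewrite ler_pM2l // (le_trans _ Qt) // lerDr mulr_ge0.
have bN : - `|be t| <= be t by rewrite lerNl -normrN ler_norm.
have : D <= h t by apply: hmin; rewrite inE.
rewrite /h le_max => /orP[hal|hbe].
- have : eps * (- Q) <= eps * (2 * be t - eps * d t ^+ 2).
    by rewrite ler_pM2l //; lra.
  lra.
- have : 0 < eps * (2 * be t - eps * d t ^+ 2) by rewrite mulr_gt0 //; lra.
  have := al0 t.
  lra.
Qed.

(** * Gordan's alternative for a compact family of vectors *)

(** The existence of a separating form c with a strict inequality depends on
    compactness: it gives a point of least norm among the convex combinations,
    where a mere infimum would only yield c with a weak inequality. *)
Lemma compact_gordan (R : realType) (T : topologicalType) (n : nat)
    (S : set T) (v : T -> 'cV[R]_n) :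
  S !=set0 -> compact S -> (forall k, continuous (fun t => v t k 0)) ->
  (exists (t : 'I_n.+1 -> T) (a : 'I_n.+1 -> R),
    [/\ forall i, S (t i), forall i, 0 <= a i, \sum_i a i = 1 &
        \sum_i a i *: v (t i) = 0]) \/
  (exists c : 'I_n -> R, forall s, S s -> 0 < \sum_k c k * v s k 0).
Proof.
move=> [s0 Ss0] cS cv.
(* Lists of n + 1 weighted points of S, a compact space by Tychonoff. *)
pose X : Type := prod_topology (fun _ : 'I_n.+1 => (T * R : topologicalType)%type).
pose box : set X := [set g | forall i, (S `*` `[0, 1]) (g i)].
pose mass : X -> R := fun g => \sum_i (g i).2.
pose D : set X := box `&` mass @^-1` [set 1].
pose x (g : X) : 'cV[R]_n := \sum_i (g i).2 *: v (g i).1.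
pose sq (y : 'cV[R]_n) : R := \sum_k y k 0 ^+ 2.
have cpr i : continuous (fun g : X => g i).
  exact: (@proj_continuous _ (fun=> (T * R : topologicalType)%type) i).
have cpt i : continuous (fun g : X => (g i).1).
  exact: comp_continuous (cpr i) (@fst_continuous _ _).
have cwt i : continuous (fun g : X => (g i).2).
  exact: comp_continuous (cpr i) (@snd_continuous _ _).
have cbox : compact box.
  apply: (@tychonoff _ (fun=> (T * R : topologicalType)%type)
    (fun=> S `*` `[0, 1])) => i.
  by apply: compact_setX => //; exact: segment_compact.
have cD : compact D.
  apply: compact_closedI => //; apply: preimage_closed; last exact: closed_eq.
  by move=> g _; exact: pointwise_sum_continuous.
have cx k : continuous (fun g => x g k 0).
  have -> : (fun g => x g k 0) = (fun g => \sum_i (g i).2 * v (g i).1 k 0).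
    by apply/funext => g; rewrite summxE; apply: eq_bigr => i _; rewrite mxE.
  apply: pointwise_sum_continuous => i; apply: pointwise_mul_continuous.
    exact: cwt.
  exact: (comp_continuous (cpt i) (cv k)).
have csq : {within D, continuous (fun g => sq (x g))}.
  apply: continuous_subspaceT; apply: pointwise_sum_continuous => k.
  by apply: pointwise_mul_continuous; exact: cx.
have D0 : D !=set0.
  exists (fun i => (s0, (i == ord0)%:R)); split.
    by move=> i; split => //=; case: (i == ord0); rewrite in_itv/= ?lexx ler01.
  rewrite /mass/= (bigD1 ord0) //= big1 ?addr0 //.
  by move=> i /negbTE ->.
have [g gD gmin] := compact_EVT_min D0 cD csq.
have [gS g1] : D g by rewrite inE in gD.
have [sq0|sqN0] := eqVneq (sq (x g)) 0.
  left; exists (fun i => (g i).1), (fun i => (g i).2); split=> //.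
  - by move=> i; have [] := gS i.
  - by move=> i; have [_] := gS i; rewrite /= in_itv => /andP[].
  - apply/matrixP => k z; rewrite {z}ord1 [RHS]mxE; apply/eqP.
    rewrite -sqrf_eq0; apply/eqP; move: sq0 => /psumr_eq0P; apply => // j _.
    exact: sqr_ge0.
right; exists (fun k => x g k 0) => s Ss.
have sq_gt0 : 0 < sq (x g).
  by rewrite lt_neqAle eq_sym sqN0 sumr_ge0 // => k _; exact: sqr_ge0.
(* Minimality extends to the segment from x g to v s, by Caratheodory. *)
have segment eps : 0 <= eps <= 1 ->
    sq (x g) <= sq ((1 - eps) *: x g + eps *: v s).
  move=> /andP[eps0 eps1].
  pose y (i : 'I_n.+2) := if unlift ord0 i is Some j then (g j).1 else s.
  pose a (i : 'I_n.+2) :=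
    if unlift ord0 i is Some j then (1 - eps) * (g j).2 else eps.
  have a0 i : 0 <= a i.
    rewrite /a; case: unliftP => [j|] _ //; rewrite mulr_ge0 ?subr_ge0 //.
    by have [_] := gS j; rewrite /= in_itv => /andP[].
  have a1 : \sum_i a i = 1.
    rewrite big_ord_recl /a unlift_none.
    under eq_bigr do rewrite liftK.
    by rewrite -mulr_sumr -/(mass g) g1 mulr1 addrC subrK.
  have [j [b [b0 b1 bx]]] := caratheodory_step (fun i => v (y i)) a0 a1.
  have <- : x (fun i => (y (lift j i), b i)) = (1 - eps) *: x g + eps *: v s.
    rewrite /x /= bx [LHS]big_ord_recl /a /y unlift_none.
    rewrite addrC scaler_sumr; congr (_ + _); apply: eq_bigr => k _.
    by rewrite liftK scalerA.
  apply: gmin; rewrite inE; split => // i; split => /=.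
    by rewrite /y; case: unliftP => // k _; have [] := gS k.
  by rewrite in_itv /= b0 /= -b1 (bigD1 i) //= lerDl sumr_ge0.
(* p is half the derivative at 0 of the squared norm along that segment. *)
pose p : R := \sum_k x g k 0 * (v s k 0 - x g k 0).
pose q : R := sq (v s - x g).
have sqE eps : sq ((1 - eps) *: x g + eps *: v s)
    = sq (x g) + eps * (2 * p + eps * q).
  rewrite /sq /p /q /sq !mulr_sumr -big_split /= mulr_sumr -big_split /=.
  by apply: eq_bigr => k _; rewrite !mxE; ring.
have q0 : 0 <= q by apply: sumr_ge0 => k _; exact: sqr_ge0.
have p0 : 0 <= p.
  rewrite leNgt; apply/negP => p0.
  have pq : 0 < q - p by lra.
  (* If p < 0, this step makes 2 * p + eps * q negative. *)
  pose eps := - p / (q - p).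
  have eps0 : 0 < eps by rewrite divr_gt0 ?oppr_gt0.
  have eps1 : eps <= 1 by rewrite ler_pdivrMr // mul1r lerDr.
  have := segment eps; rewrite ltW // eps1 sqE lerDl => /(_ isT).
  rewrite pmulr_rge0 //.
  have : eps * (q - p) = - p by rewrite divfK // gt_eqF.
  have : 0 < eps * - p by rewrite mulr_gt0 // oppr_gt0.
  lra.
suff -> : \sum_k x g k 0 * v s k 0 = p + sq (x g) by rewrite ltr_wpDl.
by rewrite /p /sq -big_split /=; apply: eq_bigr => k _; ring.
Qed.

(** * The two implications *)

Lemma polynomials_continuous (R : realType) (K : topologicalType) (n : nat)
    (phi : 'I_n -> K -> R) (q : K -> R) :
  (forall k, continuous (phi k)) -> polynomials phi q -> continuous q.
Proof.
move=> cphi [c _ <-]; rewrite fct_sumE; apply: pointwise_sum_continuous => k t.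
by apply: cvgM; [exact: cvg_cst|exact: cphi].
Qed.

Lemma alternance_best_approximation (R : realType) (K : metricType R) (n : nat)
    (phi : 'I_n -> K -> R) (f p : K -> R) :
  [set: K] !=set0 -> compact [set: K] -> (forall k, continuous (phi k)) ->
  continuous f -> polynomials phi p ->
  has_generalized_alternance phi f p -> best_approximation phi f p.
Proof.
move=> K0 cK cphi cf [c _ <-{p}] [m [tau [_ [sigma [sg alt hull]]]]] q [b _ <-{q}].
set p := \sum_(k < n) _ in alt *; set q := \sum_(k < n) _.
rewrite leNgt; apply/negP => lt_qp.
pose l (x : 'cV[R]_n) : R := \sum_k (b k - c k) * x k 0.
have lD x y : l (x + y) = l x + l y.
  by rewrite -big_split; apply: eq_bigr => k _; rewrite mxE mulrDr.
have lZ a x : l (a *: x) = a * l x.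
  by rewrite mulr_sumr; apply: eq_bigr => k _; rewrite mxE mulrCA.
have lE t : l (moment phi t) = q t - p t.
  rewrite /p /q !fct_sumE -sumrB; apply: eq_bigr => k _.
  by rewrite mxE mulrBl.
have cqf : continuous (q - f).
  move=> t; apply: cvgB; last exact: cf.
  by apply: polynomials_continuous cphi _ t; exists b.
have [_ [_ qle]] := unorm_max cK K0 cqf.
(* The half-space l < 0 contains the signed moment vectors, hence their hull. *)
suff : l 0 < 0 by rewrite -[X in l X](scale0r 0) lZ mul0r ltxx.
apply: (hull [set x | l x < 0]); split=> /=.
- move=> x y a; rewrite !inE /= => lx ly.
  rewrite /conv /= lD !lZ.
  have := @convR_gt0 _ (- l x) (- l y) a; rewrite !oppr_gt0 => /(_ lx ly).
  by rewrite convRE !mulrN -opprD oppr_gt0.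
- move=> _ [i _ <-] /=; rewrite lZ lE.
  have := le_lt_trans (qle (tau i)) lt_qp.
  have := alt i; rewrite ltr_norml => + /andP[].
  rewrite !fctE => pf q1 q2.
  by case: (sg i) => E; rewrite E in pf *; lra.
Qed.

Lemma best_approximation_alternance (R : realType) (K : metricType R) (n : nat)
    (phi : 'I_n -> K -> R) (f p : K -> R) :
  [set: K] !=set0 -> compact [set: K] -> (forall k, continuous (phi k)) ->
  continuous f -> polynomials phi p ->
  best_approximation phi f p -> has_generalized_alternance phi f p.
Proof.
move=> K0 cK cphi cf pp best.
have cpf : continuous (p - f).
  by move=> t; apply: cvgB; [exact: polynomials_continuous cphi pp t|exact: cf].
have [t0 [Nt0 leN]] := unorm_max cK K0 cpf.
set N := unorm (p - f) in Nt0 leN.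
pose S : set (K * R) := [set x | x.2 ^+ 2 = 1 /\ (p - f) x.1 - x.2 * N = 0].
pose v (x : K * R) : 'cV[R]_n := x.2 *: moment phi x.1.
have sign2 (a : R) : a ^+ 2 = 1 -> a = -1 \/ a = 1.
  by move=> /eqP; rewrite sqrf_eq1 => /orP[/eqP ->|/eqP ->]; [right|left].
have S0 : S !=set0.
  have [e0|e0] := leP 0 ((p - f) t0).
    by exists (t0, 1); split=> /=; rewrite ?expr1n // mul1r Nt0 ger0_norm ?subrr.
  exists (t0, -1); split=> /=; first by rewrite sqrrN expr1n.
  by rewrite Nt0 mulN1r opprK ltr0_norm ?subrr.
have cS : compact S.
  have -> : S = ([set: K] `*` `[-1, 1]) `&`
      (((fun x : K * R => x.2 ^+ 2) @^-1` [set 1]) `&`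
       ((fun x : K * R => (p - f) x.1 - x.2 * N) @^-1` [set 0])).
    apply/seteqP; split=> [x [x1 x2]|x [_ [x1 x2]]]; split=> //.
    split=> //=; rewrite in_itv /=.
    by case: (sign2 _ x1) => ->; lra.
  apply: compact_closedI.
    apply: compact_setX => //; exact: segment_compact.
  apply: closedI; apply: preimage_closed; try exact: closed_eq.
    by move=> x _; apply: cvgM; exact: snd_continuous.
  move=> x _; apply: cvgB.
    exact: (comp_continuous (@fst_continuous _ _) cpf).
  by apply: cvgM; [exact: snd_continuous|exact: cvg_cst].
have cv k : continuous (fun x => v x k 0).
  have -> : (fun x => v x k 0) = (fun x => x.2 * phi k x.1).
    by apply/funext => x; rewrite !mxE.
  move=> x; apply: cvgM; first exact: snd_continuous.
  exact: (comp_continuous (@fst_continuous _ _) (cphi k)).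
have [[t [a [St a0 a1 av]]]|[c cS0]] := compact_gordan S0 cS cv.
  exists n.+1, (fun i => (t i).1); split; first by rewrite ltnS leqnn.
  exists (fun i => (t i).2); split.
  - by move=> i; have [/sign2] := St i.
  - by move=> i; have [_ /eqP] := St i; rewrite subr_eq0 => /eqP.
  - move=> A [cA subA]; rewrite -[X in A X]av.
    apply: convex_set_sum => // i; exact: subA.
exfalso.
pose d : K -> R := \sum_(k < n) c k *: phi k.
have cd : continuous d by apply: polynomials_continuous cphi _; exists c.
have dS s : S s -> 0 < s.2 * d s.1.
  move=> /cS0; congr (_ < _); rewrite /d fct_sumE mulr_sumr.
  by apply: eq_bigr => k _; rewrite !mxE mulrCA.
(* If N were 0, both signs would be extremal at t0 and d would have both. *)
have N_gt0 : 0 < N.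
  rewrite lt_neqAle Nt0 normr_ge0 andbT -Nt0; apply/eqP => N0.
  have e0 : (p - f) t0 = 0 by apply/eqP; rewrite -normr_eq0 -Nt0 -N0.
  have := dS (t0, 1); have := dS (t0, -1).
  rewrite /S /= sqrrN expr1n e0 -N0 !mulr0 subr0.
  by move=> /(_ (conj erefl erefl)) + /(_ (conj erefl erefl)); lra.
have [t|eps epsN] := @uniform_decrease R K (p - f) d N K0 cK cpf cd leN.
  move=> tN; pose s : R := (p - f) t / N.
  have sN : (p - f) t = s * N by rewrite divfK // gt_eqF.
  rewrite sN mulrAC pmulr_lgt0 //; apply: (dS (t, s)); split => /=.
    rewrite -real_normK ?num_real // normrM tN normfV.
    by rewrite ger0_norm ?ltW // divff ?gt_eqF // expr1n.
  by rewrite sN subrr.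
have pq : polynomials phi (p - eps *: d).
  case: pp => b _ <-; exists (fun k => b k - eps * c k) => //.
  rewrite /d scaler_sumr -sumrB; apply: eq_bigr => k _.
  by rewrite scalerBl scalerA.
have cq : continuous (p - eps *: d - f).
  by move=> t; apply: cvgB; [exact: polynomials_continuous cphi pq t|exact: cf].
have [t [Et _]] := unorm_max cK K0 cq.
have := best _ pq; rewrite Et leNgt => /negP; apply.
by have := epsN t; rewrite !fctE addrAC.
Qed.

Theorem theorem1 (R : realType) (K : metricType R)
    (K0 : [set: K] !=set0) (cK : compact [set: K])
    (n : nat) (phi : 'I_n -> K -> R)
    (cphi : forall k, continuous (phi k)) (iphi : linearly_independent phi)
    (f : K -> R) (cf : continuous f)
    (p : K -> R) (hp : polynomials phi p) :
  best_approximation phi f p <-> has_generalized_alternance phi f p.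
Proof.
split; first exact: best_approximation_alternance.
exact: alternance_best_approximation.
Qed.
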